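(* Let $\mathbf D=(D,\sqcap,{}',0,1)$ be an ortho-directoid. Define a partial binary operation $\oplus$ on $D$ by: for $x,y\in D$, $x\oplus y:=x\sqcup y$ if $x\leq y'$, and $x\oplus y$ is undefined otherwise. Then $\mathcal O(\mathbf D):=(D,\oplus,{}',0,1)$ is an orthoalgebra.
   Context: An ortho-directoid is an algebra $(D,\sqcap,{}',0,1)$ of type $(2,1,0,0)$ satisfying, with $x\sqcup y:=(x'\sqcap y')'$, the identities: (i) $x\sqcap y\approx y\sqcap x$; (ii) $x\sqcup x'\approx1$; (iii) $0\sqcup x\approx x$; (iv) $((x\sqcap y')\sqcup y)\sqcup(((x\sqcap y')\sqcup y)\sqcup z)'\approx(x\sqcap y')\sqcup(y\sqcup(((x\sqcap y')\sqcup y)\sqcup z)')$; (v) $(x\sqcap y)\sqcup((x\sqcap y)\sqcup y')'\approx y$; (vi) $(x\sqcap y')\sqcup(y\sqcup(((x\sqcap y')\sqcup y)\sqcup z)')'\approx(y\sqcup(((x\sqcap y')\sqcup y)\sqcup z)')'$. The induced relation is $x\leq y$ iff $x\sqcap y=x$. An effect algebra is a partial algebra $(E,\oplus,0,1)$ such that for all $x,y,z$: if $x\oplus y$ exists so does $y\oplus x$ and they are equal; if $x\oplus y$ and $(x\oplus y)\oplus z$ exist, so do $y\oplus z$ and $x\oplus(y\oplus z)$ and $(x\oplus y)\oplus z=x\oplus(y\oplus z)$; there is a unique $x'$ such that $x\oplus x'$ is defined and equals $1$; if $x\oplus1$ exists then $x=0$. The operation ${}'$ is regarded as an additional fundamental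 operation, written $(E,\oplus,{}',0,1)$. Its induced order is $a\leq b$ iff $a\oplus c=b$ for some $c$; with it $(E,\leq,{}',0,1)$ is a bounded poset with antitone involution. An orthoposet is a bounded poset with an antitone involution ${}'$ that is a complementation ($x\wedge x'=0$, $x\vee x'=1$). An orthoalgebra is an effect algebra whose induced poset is an orthoposet. *)

(* Defs.v *)
From Stdlib Require Import Relation_Definitions ClassicalEpsilon.

Set Implicit Arguments.
Unset Strict Implicit.

Record algebra := Algebra {
  carrier :> Type;
  meet : carrier -> carrier -> carrier;
  inv : carrier -> carrier;
  zero : carrier;
  one : carrier
}.

Arguments zero {_}.
Arguments one {_}.

Definition join (A : algebra) (x y : A) : A := inv (meet (inv x) (inv y)).

Declare Scope directoid_scope.
Delimit Scope directoid_scope with dir.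
Notation "x ⊓ y" := (meet x y) (at level 40, left associativity) : directoid_scope.
Notation "x ⊔ y" := (join x y) (at level 50, left associativity) : directoid_scope.
Notation "x ^⊥" := (inv x) (at level 2, left associativity, format "x ^⊥") : directoid_scope.

Local Open Scope directoid_scope.

Record is_ortho_directoid (A : algebra) : Prop := {
  od_comm : forall x y : A, x ⊓ y = y ⊓ x;
  od_compl : forall x : A, x ⊔ x^⊥ = one;
  od_zero : forall x : A, zero ⊔ x = x;
  od_assoc : forall x y z : A,
    ((x ⊓ y^⊥) ⊔ y) ⊔ (((x ⊓ y^⊥) ⊔ y) ⊔ z)^⊥
    = (x ⊓ y^⊥) ⊔ (y ⊔ (((x ⊓ y^⊥) ⊔ y) ⊔ z)^⊥);
  od_orthomod : forall x y : A,
    (x ⊓ y) ⊔ ((x ⊓ y) ⊔ y^⊥)^⊥ = y;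
  od_defined : forall x y z : A,
    (x ⊓ y^⊥) ⊔ (y ⊔ (((x ⊓ y^⊥) ⊔ y) ⊔ z)^⊥)^⊥
    = (y ⊔ (((x ⊓ y^⊥) ⊔ y) ⊔ z)^⊥)^⊥
}.

Definition dir_le (A : algebra) (x y : A) : Prop := x ⊓ y = x.

(* [plus x y = None] means that the sum of x and y is undefined. *)
Record partial_algebra := PartialAlgebra {
  pcarrier :> Type;
  plus : pcarrier -> pcarrier -> option pcarrier;
  pinv : pcarrier -> pcarrier;
  pzero : pcarrier;
  pone : pcarrier
}.

Arguments pzero {_}.
Arguments pone {_}.

(* The axioms on (plus, 0, 1) come first; [ea_inv] then says that [pinv] is
   the operation determined by [ea_inv_unique]. *)
Record is_effect_algebra (E : partial_algebra) : Prop := {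
  ea_comm : forall x y s : E, plus x y = Some s -> plus y x = Some s;
  ea_assoc : forall x y z s t : E,
    plus x y = Some s -> plus s z = Some t ->
    exists u : E, plus y z = Some u /\ plus x u = Some t;
  ea_inv_unique : forall x : E, exists! y : E, plus x y = Some pone;
  ea_one : forall x : E, (exists s : E, plus x pone = Some s) -> x = pzero;
  ea_inv : forall x : E, plus x (pinv x) = Some pone
}.

Definition ea_le (E : partial_algebra) (a b : E) : Prop :=
  exists c : E, plus a c = Some b.

Definition is_meet (T : Type) (le : relation T) (x y m : T) : Prop :=
  le m x /\ le m y /\ forall z : T, le z x -> le z y -> le z m.

Definition is_join (T : Type) (le : relation T) (x y j : T) : Prop :=
  le x j /\ le y j /\ forall z : T, le x z -> le y z -> le j z.

Record is_orthoposet (T : Type) (le : relation T) (c : T -> T) (bot top : T) :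
    Prop := {
  op_order : order T le;
  op_bot : forall x : T, le bot x;
  op_top : forall x : T, le x top;
  op_antitone : forall x y : T, le x y -> le (c y) (c x);
  op_involutive : forall x : T, c (c x) = x;
  op_meet : forall x : T, is_meet le x (c x) bot;
  op_join : forall x : T, is_join le x (c x) top
}.

Definition is_orthoalgebra (E : partial_algebra) : Prop :=
  is_effect_algebra E /\ is_orthoposet (@ea_le E) (@pinv E) pzero pone.

Definition orthoalgebra_of (D : algebra) : partial_algebra := {|
  pcarrier := D;
  plus := fun x y : D =>
    if excluded_middle_informative (dir_le x (y^⊥)) then Some (x ⊔ y) else None;
  pinv := @inv D;
  pzero := zero;
  pone := one
|}.

(* Main.v *)
Require Import Defs.
From Stdlib Require Import ClassicalEpsilon.

Local Open Scope directoid_scope.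

(** The induced relation [x ≤ y] of an ortho-directoid is first shown to be
    reflexive and antisymmetric, with [x ⊓ y] a (not necessarily greatest) lower
    bound of [x] and [y] and with [inv] an antitone involution.  All of this
    comes from degenerate instances of the identities, in which some term
    collapses to [zero] or [one].

    The remaining content sits in three identities: each of them mentions an
    element [x ⊓ y] or [x ⊓ y^⊥], and [x ⊓ y] ranges exactly over the elements
    below [y].  So [od_orthomod] says that [x ≤ y] implies
    [y = x ⊔ (x ⊔ y^⊥)^⊥] ([orthomodular]), and [od_assoc], [od_defined] say that
    for [x ≤ y^⊥] the sums of [x], [y] and [((x ⊔ y) ⊔ z)^⊥] associate and are
    defined.  By [orthomodular], every element orthogonal to [x ⊔ y] is of the
    form [((x ⊔ y) ⊔ z)^⊥], whence associativity of the partial sum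
    ([sum_assoc]).  Orthomodularity also identifies the order of the effect
    algebra with [≤] ([ea_le_iff]) and makes complements unique.

    Transitivity of [≤] is not among the easy properties: it is inherited from
    the effect algebra, where [a ⊕ c = b] and [b ⊕ d = e] give
    [a ⊕ (c ⊕ d) = e].  Complementation is then immediate, since [z ≤ x] and
    [z ≤ x^⊥] force [z ≤ z^⊥], and [z ⊓ z^⊥ = zero]. *)

Section OrthoDirectoid.

Variables (D : algebra) (HD : is_ortho_directoid D).
Implicit Types x y z : D.

Local Notation "x ≤ y" := (dir_le x y) (at level 70).

Lemma inv_zero : (zero : D)^⊥ = one.
Proof. now rewrite <- (od_compl HD zero), (od_zero HD). Qed.

(** [od_zero] exhibits [x] as a function of [x^⊥]. *)
Lemma inv_inj x y : x^⊥ = y^⊥ -> x = y.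
Proof.
intros E. rewrite <- (od_zero HD x), <- (od_zero HD y).
unfold join. now rewrite E.
Qed.

(** Every element is a complement, by [od_zero]; for [x = u^⊥] the element
    [(x ⊓ x^⊥)^⊥] is by definition [u ⊔ u^⊥]. *)
Lemma meet_inv x : x ⊓ x^⊥ = zero.
Proof.
rewrite <- (od_zero HD x). unfold join at 1 2.
apply inv_inj. rewrite inv_zero. apply (od_compl HD).
Qed.

(** Orthomodularity at the pair [x^⊥], [x], whose meet is [zero]. *)
Lemma inv_inv x : x^⊥^⊥ = x.
Proof.
pose proof (od_orthomod HD (x^⊥) x) as H.
now rewrite (od_comm HD _ x), meet_inv, !(od_zero HD) in H.
Qed.

Lemma inv_one : (one : D)^⊥ = zero.
Proof. now rewrite <- inv_zero, inv_inv. Qed.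

Lemma inv_join x y : (x ⊔ y)^⊥ = x^⊥ ⊓ y^⊥.
Proof. apply inv_inv. Qed.

Lemma inv_meet x y : (x ⊓ y)^⊥ = x^⊥ ⊔ y^⊥.
Proof. unfold join. now rewrite !inv_inv. Qed.

Lemma join_comm x y : x ⊔ y = y ⊔ x.
Proof. unfold join. now rewrite (od_comm HD). Qed.

Lemma join_zero x : x ⊔ zero = x.
Proof. now rewrite join_comm, (od_zero HD). Qed.

Lemma meet_one x : x ⊓ one = x.
Proof. apply inv_inj. now rewrite inv_meet, inv_one, join_zero. Qed.

(** Taking [z = s^⊥] with [s = (x ⊓ y) ⊔ y^⊥] in [od_defined] makes
    [(s ⊔ z)^⊥] vanish. *)
Lemma meet_join_absorb x y : (x ⊓ y) ⊔ y = y.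
Proof.
pose proof (od_defined HD x (y^⊥) (((x ⊓ y^⊥^⊥) ⊔ y^⊥)^⊥)) as H.
now rewrite (od_compl HD), inv_one, join_zero, !inv_inv in H.
Qed.

(** Absorption gives one direction, absorption for the complements the
    other. *)
Lemma le_iff_join x y : x ≤ y <-> x ⊔ y = y.
Proof.
unfold dir_le. split; intros E.
- rewrite <- E. apply meet_join_absorb.
- apply inv_inj. rewrite inv_meet, join_comm.
  rewrite <- E at 1. rewrite inv_join, (od_comm HD). apply meet_join_absorb.
Qed.

Lemma inv_antitone x y : x ≤ y -> y^⊥ ≤ x^⊥.
Proof.
intros L. unfold dir_le. rewrite (od_comm HD), <- inv_join. f_equal.
now apply le_iff_join.
Qed.

Lemma le_inv_sym x y : x ≤ y^⊥ -> y ≤ x^⊥.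
Proof. intros L. apply inv_antitone in L. now rewrite inv_inv in L. Qed.

Lemma le_join_l x y : x ≤ x ⊔ y.
Proof.
apply le_iff_join, inv_inj.
rewrite !inv_join, (od_comm HD (x^⊥) (_ ⊓ _)), (od_comm HD (x^⊥)).
apply le_iff_join, meet_join_absorb.
Qed.

Lemma zero_le x : zero ≤ x.
Proof. apply le_iff_join, (od_zero HD). Qed.

Lemma le_one x : x ≤ one.
Proof. apply meet_one. Qed.

Lemma le_refl x : x ≤ x.
Proof. rewrite <- (join_zero x) at 2. apply le_join_l. Qed.

Lemma le_antisym x y : x ≤ y -> y ≤ x -> x = y.
Proof. unfold dir_le. rewrite (od_comm HD y). congruence. Qed.

Lemma orthomodular x y : x ≤ y -> x ⊔ (x ⊔ y^⊥)^⊥ = y.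
Proof. intros L. pose proof (od_orthomod HD x y) as H. now rewrite L in H. Qed.

Lemma assoc_below x y z : x ≤ y^⊥ ->
  (x ⊔ y) ⊔ ((x ⊔ y) ⊔ z)^⊥ = x ⊔ (y ⊔ ((x ⊔ y) ⊔ z)^⊥).
Proof. intros L. pose proof (od_assoc HD x y z) as H. now rewrite L in H. Qed.

Lemma defined_below x y z : x ≤ y^⊥ -> x ≤ (y ⊔ ((x ⊔ y) ⊔ z)^⊥)^⊥.
Proof.
intros L. pose proof (od_defined HD x y z) as H. rewrite L in H.
now apply le_iff_join.
Qed.

Lemma complement_unique x y : x ≤ y^⊥ -> x ⊔ y = one -> y = x^⊥.
Proof.
intros L E. pose proof (orthomodular _ _ (le_inv_sym _ _ L)) as H.
now rewrite inv_inv, join_comm, (join_comm y), E, inv_one, (od_zero HD) in H.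
Qed.

(** An element [z] orthogonal to [x ⊔ y] equals [((x ⊔ y) ⊔ w)^⊥] for
    [w = ((x ⊔ y) ⊔ z)^⊥], so that [assoc_below] and [defined_below] apply to
    it.  Since transitivity of [≤] will be deduced from this lemma, [y ≤ z^⊥]
    needs another reason than [y ≤ x ⊔ y ≤ z^⊥]: the element
    [z^⊥ = (y ⊔ x) ⊔ w] reassociates to the upper bound [y ⊔ (x ⊔ w)] of [y]. *)
Lemma sum_assoc x y z : x ≤ y^⊥ -> x ⊔ y ≤ z^⊥ ->
  y ≤ z^⊥ /\ x ≤ (y ⊔ z)^⊥ /\ x ⊔ (y ⊔ z) = (x ⊔ y) ⊔ z.
Proof.
intros Lxy Lz. pose proof (orthomodular _ _ Lz) as E.
rewrite inv_inv in E.
assert (Ez : ((x ⊔ y) ⊔ ((x ⊔ y) ⊔ z)^⊥)^⊥ = z) by now rewrite E, inv_inv.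
split; [|split].
- rewrite <- E, (join_comm x), (assoc_below _ _ _ (le_inv_sym _ _ Lxy)).
  apply le_join_l.
- rewrite <- Ez. now apply defined_below.
- rewrite <- Ez at 1 2. symmetry. now apply assoc_below.
Qed.

Local Notation E := (orthoalgebra_of D).

Lemma plus_Some (x y s : E) :
  plus x y = Some s <-> dir_le (A := D) x (inv (a := D) y) /\ join (A := D) x y = s.
Proof.
cbn. destruct excluded_middle_informative as [L|L]; split.
- now intros [= <-].
- now intros [_ <-].
- discriminate.
- now intros [? _].
Qed.

Lemma effect_algebra : is_effect_algebra E.
Proof.
split.
- intros x y s [L <-]%plus_Some. apply plus_Some.
  split; [now apply le_inv_sym | apply join_comm].
- intros x y z s t [Lxy <-]%plus_Some [Lz <-]%plus_Some.
  destruct (sum_assoc _ _ _ Lxy Lz) as (Lyz & Lx & Ea).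
  exists (join (A := D) y z). now rewrite !plus_Some.
- intros x. exists (inv (a := D) x). split.
  + apply plus_Some. rewrite inv_inv. split; [apply le_refl | apply (od_compl HD)].
  + intros y [L Ey]%plus_Some. symmetry. now apply complement_unique.
- intros x [s [L _]%plus_Some]. cbn in L |- *. rewrite inv_one in L.
  apply le_antisym; [exact L | apply zero_le].
- intros x. apply plus_Some. cbn. rewrite inv_inv.
  split; [apply le_refl | apply (od_compl HD)].
Qed.

(** If [x ≤ y], orthomodularity provides the difference [(x ⊔ y^⊥)^⊥]. *)
Lemma ea_le_iff x y : ea_le (E := E) x y <-> x ≤ y.
Proof.
split.
- intros [c [_ <-]%plus_Some]. apply le_join_l.
- intros L. exists (inv (a := D) (x ⊔ y^⊥)). apply plus_Some.
  rewrite inv_inv. split; [apply le_join_l | now apply orthomodular].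
Qed.

Lemma le_trans x y z : x ≤ y -> y ≤ z -> x ≤ z.
Proof.
rewrite <- !ea_le_iff. intros [c Hc] [d Hd].
destruct (ea_assoc effect_algebra Hc Hd) as (u & _ & Hu). now exists u.
Qed.

Lemma meet_inv_greatest x z : z ≤ x -> z ≤ x^⊥ -> z ≤ zero.
Proof.
intros L L'.
assert (Lz : z ≤ z^⊥) by now apply le_trans with (x^⊥); [|apply inv_antitone].
unfold dir_le in Lz. rewrite meet_inv in Lz. rewrite <- Lz. apply zero_le.
Qed.

Lemma orthoposet : is_orthoposet (@ea_le E) (@pinv E) pzero pone.
Proof.
split; [split | ..]; cbn.
- intros x. apply ea_le_iff, le_refl.
- intros x y z. rewrite !ea_le_iff. apply le_trans.
- intros x y. rewrite !ea_le_iff. apply le_antisym.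
- intros x. apply ea_le_iff, zero_le.
- intros x. apply ea_le_iff, le_one.
- intros x y. rewrite !ea_le_iff. apply inv_antitone.
- apply inv_inv.
- intros x. repeat split; try apply ea_le_iff, zero_le.
  intros z. rewrite !ea_le_iff. apply meet_inv_greatest.
- intros x. repeat split; try apply ea_le_iff, le_one.
  intros z. rewrite !ea_le_iff. intros L L'.
  rewrite <- (inv_inv z), <- inv_zero.
  apply inv_antitone, meet_inv_greatest with (x^⊥); now apply inv_antitone.
Qed.

End OrthoDirectoid.

Theorem theorem3p24 (D : algebra) (HD : is_ortho_directoid D) :
  is_orthoalgebra (orthoalgebra_of D).
Proof. split; [now apply effect_algebra | now apply orthoposet]. Qed.
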